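(* Every consistent set $\Gamma$ of conditions is satisfiable; that is, if $\Gamma\nvdash 1\leqslant 0$ then there are a topological model $M=(X,\mathbf v)$ and a point $x\in X$ such that $M\vDash_x\Gamma$.
   Context: Syntax. Fix a countable set $\mathbb P$ of atomic propositions. (Affine) propositions are built inductively: $1$, every $p\in\mathbb P$, $\phi+\psi$, $r\phi$ ($r\in\mathbb R$), $\Box\phi$. Abbreviations: a real number $r$ used as a proposition means $r1$ (so $0$ is $0\cdot 1$); $-\phi$ is $(-1)\phi$; $\phi-\psi$ is $\phi+(-1)\psi$. A condition is an expression $\phi\leqslant\psi$ with $\phi,\psi$ propositions; $\phi=\psi$ stands for the two conditions $\phi\leqslant\psi$, $\psi\leqslant\phi$. A theory is a set of conditions. Proof system. Logical axioms (for all propositions $\phi,\psi,\theta$ and reals $r,s$): (A1) $r\leqslant s$, whenever $r\leqslant s$ holds in $\mathbb R$; (A2) $\phi+(\psi+\theta)=(\phi+\psi)+\theta$; (A3) $\phi+\psi=\psi+\phi$; (A4) $0+\phi=\phi$; (A5) $r(\phi+\psi)=r\phi+r\psi$; (A6) $(r+s)\phi=r\phi+s\phi$; (A7) $r(s\phi)=(rs)\phi$; (A8) $1\phi=\phi$; (A9) $0\phi=0$; (A10) $0\leqslant p$ and $p\leqslant 1$ for $p\in\mathbb P$; (A11) $\Box(\phi-\psi)\leqslant\Box\phi-\Box\psi$; (A12) $\Box\phi\leqslant\phi$; (A13) $\Box\phi\leqslant\Box\Box\phi$; (A14) $\Box(r\phi)=r\Box\phi$ for $r\geqslant0$; (A15)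 $\Box r=r$. Rules: (R1) from $\phi\leqslant\psi$ infer $\phi+\theta\leqslant\psi+\theta$; (R2) from $0\leqslant r$ and $\phi\leqslant\psi$ infer $r\phi\leqslant r\psi$; (R3) from $\phi\leqslant\psi$ and $\psi\leqslant\theta$ infer $\phi\leqslant\theta$; (R4) from $\phi\leqslant\psi$ infer $\Box\phi\leqslant\Box\psi$. $\Vdash\mathcal S$ means that the condition $\mathcal S$ is derivable from the logical axioms by finitely many applications of (R1)-(R4). For a theory $\Gamma$: $\Gamma\vdash_0\mathcal S$ if $\Vdash\mathcal S$ or $\mathcal S\in\Gamma$; for $n>0$, $\Gamma\vdash_n\mathcal S$ if for some $k<n$ either $\Gamma\vdash_k\mathcal S$ or $\mathcal S$ follows by one application of (R1), (R2) or (R3) (not (R4)) from conditions $\mathcal S'$ with $\Gamma\vdash_k\mathcal S'$. $\Gamma\vdash\mathcal S$ means $\Gamma\vdash_n\mathcal S$ for some $n$. $\Gamma$ is inconsistent if $\Gamma\vdash 1\leqslant 0$, and consistent otherwise. Semantics. A topological model is a pair $M=(X,\mathbf v)$ with $X$ a topological space and $\mathbf v$ assigning to each $p\in\mathbb P$ an arbitrary map $\mathbf v_p:X\to[0,1]$. The value $\phi^M:X\to\mathbb R$ is defined by $1^M(x)=1$, $p^M(x)=\mathbf v_p(x)$, $(\phi+\psi)^M=\phi^M+\psi^M$, $(r\phi)^M=r\phi^M$, and $(\Box\phi)^M(x)=\sup\{\inf_{t\in U}\phi^M(t): U\ni x \text{ open}\}$ (the lower semi-continuous envelope of $\phi^M$).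 $M\vDash_x\phi\leqslant\psi$ means $\phi^M(x)\leqslant\psi^M(x)$; $M\vDash_x\Gamma$ means $M\vDash_x\mathcal S$ for all $\mathcal S\in\Gamma$. *)

(* Defs.v *)
From HB Require Import structures.
From mathcomp Require Import all_boot all_order all_algebra.
From mathcomp Require Import all_classical all_reals all_analysis.

Set Implicit Arguments.
Unset Strict Implicit.
Unset Printing Implicit Defensive.

Import Order.TTheory GRing.Theory Num.Theory.
Local Open Scope classical_set_scope.
Local Open Scope ring_scope.

(** * Syntax *)

Inductive prp (R : realType) (P : Type) : Type :=
| One
| Atom of P
| Plus of prp R P & prp R P
| Scale of R & prp R P
| Box of prp R P.

Arguments One {R P}.
Arguments Atom {R P} p.

Inductive condition (R : realType) (P : Type) : Type :=
| Le of prp R P & prp R P.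

Notation theory R P := (set (condition R P)).

Declare Scope affine_scope.
Delimit Scope affine_scope with A.
Bind Scope affine_scope with prp.
Bind Scope affine_scope with condition.

Definition Real {R : realType} {P : Type} (r : R) : prp R P := Scale r One.

Definition Minus {R : realType} {P : Type} (phi psi : prp R P) : prp R P :=
  Plus phi (Scale (-1) psi).

Notation "phi + psi" := (Plus phi psi) : affine_scope.
Notation "phi - psi" := (Minus phi psi) : affine_scope.
Notation "r *: phi" := (Scale r%R phi) : affine_scope.
Notation "phi <= psi" := (Le phi psi) : affine_scope.

(** * Proof system *)

(* The axioms of the form [phi = psi]; each one stands for the two conditions
   [phi <= psi] and [psi <= phi]. *)
Inductive eq_axiom (R : realType) (P : Type) : prp R P -> prp R P -> Prop :=
| ax_addA phi psi theta :
    eq_axiom (phi + (psi + theta))%A ((phi + psi) + theta)%A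
| ax_addC phi psi : eq_axiom (phi + psi)%A (psi + phi)%A
| ax_add0 phi : eq_axiom (Real 0 + phi)%A phi
| ax_scaleDr r phi psi :
    eq_axiom (r *: (phi + psi))%A (r *: phi + r *: psi)%A
| ax_scaleDl (r s : R) phi :
    eq_axiom ((r + s) *: phi)%A (r *: phi + s *: phi)%A
| ax_scaleA (r s : R) phi :
    eq_axiom (r *: (s *: phi))%A ((r * s) *: phi)%A
| ax_scale1 phi : eq_axiom (1 *: phi)%A phi
| ax_scale0 phi : eq_axiom (0 *: phi)%A (Real 0)
| ax_box_scale (r : R) phi :
    0 <= r -> eq_axiom (Box (r *: phi)) (r *: Box phi)%A
| ax_box_real (r : R) : eq_axiom (Box (Real r)) (Real r).

Inductive logical_axiom (R : realType) (P : Type) : condition R P -> Prop :=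
| ax_eq_le phi psi : eq_axiom phi psi -> logical_axiom (phi <= psi)%A
| ax_eq_ge phi psi : eq_axiom phi psi -> logical_axiom (psi <= phi)%A
| ax_real (r s : R) : r <= s -> logical_axiom (Real r <= Real s)%A
| ax_atom_ge0 (p : P) : logical_axiom (Real 0 <= Atom p)%A
| ax_atom_le1 (p : P) : logical_axiom (Atom p <= One)%A
| ax_box_sub phi psi :
    logical_axiom (Box (phi - psi) <= Box phi - Box psi)%A
| ax_boxT phi : logical_axiom (Box phi <= phi)%A
| ax_box4 phi : logical_axiom (Box phi <= Box (Box phi))%A.

(* In [thm_scale] and [der_scale] the premise [0 <= r] is itself a condition of
   the logic, between the propositions [0] and [r]. *)
Inductive theorem_of (R : realType) (P : Type) : condition R P -> Prop :=
| thm_axiom S : logical_axiom S -> theorem_of S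
| thm_add phi psi theta :
    theorem_of (phi <= psi)%A -> theorem_of (phi + theta <= psi + theta)%A
| thm_scale (r : R) phi psi :
    theorem_of (Real 0 <= Real r)%A -> theorem_of (phi <= psi)%A ->
    theorem_of (r *: phi <= r *: psi)%A
| thm_trans phi psi theta :
    theorem_of (phi <= psi)%A -> theorem_of (psi <= theta)%A ->
    theorem_of (phi <= theta)%A
| thm_box phi psi :
    theorem_of (phi <= psi)%A -> theorem_of (Box phi <= Box psi)%A.

Inductive derivable_at (R : realType) (P : Type) (Gamma : theory R P) :
    nat -> condition R P -> Prop :=
| der_thm S : theorem_of S -> derivable_at Gamma 0 S
| der_hyp S : Gamma S -> derivable_at Gamma 0 S
| der_keep k n S :
    (k < n)%N -> derivable_at Gamma k S -> derivable_at Gamma n S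
| der_add k n phi psi theta :
    (k < n)%N -> derivable_at Gamma k (phi <= psi)%A ->
    derivable_at Gamma n (phi + theta <= psi + theta)%A
| der_scale k n (r : R) phi psi :
    (k < n)%N -> derivable_at Gamma k (Real 0 <= Real r)%A ->
    derivable_at Gamma k (phi <= psi)%A ->
    derivable_at Gamma n (r *: phi <= r *: psi)%A
| der_trans k n phi psi theta :
    (k < n)%N -> derivable_at Gamma k (phi <= psi)%A ->
    derivable_at Gamma k (psi <= theta)%A ->
    derivable_at Gamma n (phi <= theta)%A.

Definition derivable_from (R : realType) (P : Type) (Gamma : theory R P)
    (S : condition R P) : Prop :=
  exists n, derivable_at Gamma n S.

Definition inconsistent (R : realType) (P : Type) (Gamma : theory R P) : Prop :=
  derivable_from Gamma (One <= Real 0)%A.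

Definition consistent (R : realType) (P : Type) (Gamma : theory R P) : Prop :=
  ~ inconsistent Gamma.

(** * Semantics *)

Record topological_model (R : realType) (P : Type) := TopologicalModel {
  space :> topologicalType;
  valuation : P -> space -> R;
  valuation01 : forall p x, 0 <= valuation p x <= 1
}.

(* [sup] and [inf] are those of [R], hence meaningful only on bounded nonempty
   sets. In [value] below they are applied only to such sets: [U] contains [x],
   and every [value M phi] is bounded because valuations lie in [0, 1]. *)
Definition lsc_envelope (R : realType) (X : topologicalType) (f : X -> R)
    (x : X) : R :=
  sup [set inf (f @` U) | U in open_nbhs x].

Fixpoint value (R : realType) (P : Type) (M : topological_model R P)
    (phi : prp R P) : M -> R :=
  match phi with
  | One => fun=> 1
  | Atom p => valuation p
  | Plus phi psi => fun x => value phi x + value psi x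
  | Scale r phi => fun x => r * value phi x
  | Box phi => lsc_envelope (value phi)
  end.

Definition sat (R : realType) (P : Type) (M : topological_model R P) (x : M)
    (S : condition R P) : Prop :=
  let: Le phi psi := S in value phi x <= value psi x.

Definition sat_theory (R : realType) (P : Type) (M : topological_model R P)
    (x : M) (Gamma : theory R P) : Prop :=
  forall S, Gamma S -> sat x S.

Definition satisfiable (R : realType) (P : Type) (Gamma : theory R P) : Prop :=
  exists (M : topological_model R P) (x : M), sat_theory x Gamma.

(* Main.v *)
From mathcomp Require Import all_boot all_order all_algebra.
From mathcomp Require Import all_classical all_reals all_analysis.
From HB Require Import structures.
From mathcomp Require Import lra.
From Stdlib Require Import -(notations) Setoid Morphisms.
Require Import Defs.

Set Implicit Arguments.
Unset Strict Implicit.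
Unset Printing Implicit Defensive.

Import Order.TTheory GRing.Theory Num.Theory.
Local Open Scope classical_set_scope.
Local Open Scope ring_scope.

(** The proof is a completeness argument by a canonical model whose points are
    the _states_: the maps [T] from propositions to reals that are linear, are
    monotone for provable inequality, and send [Real r] to [r].

    A consistent theory has a state satisfying it.  The bound
    [q phi = sup {r | Gamma derives r <= phi}] is finite because provably every
    proposition lies between two constants and because [Gamma] is consistent.
    It is superlinear: superadditive, positively homogeneous and monotone.  By
    Hahn-Banach ([state_above]) some state [T] lies above [q], and
    [T psi - T phi >= q (psi - phi) >= 0] for every [phi <= psi] in [Gamma].

    The modality is read off the order on states in which [T'] is accessible
    from [T] when [T (Box phi) <= T' phi] for all [phi].  The axioms
    [Box phi <= phi] and [Box phi <= Box (Box phi)] make this relation reflexive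
    and transitive, so its up-closed sets form a topology in which every point
    has a least neighbourhood, and the lower envelope at [T] of the evaluation
    at [phi] is the infimum of [T' phi] over the [T'] accessible from [T].  That
    infimum is at least [T (Box phi)] by definition.  It is attained
    ([state_box_attained]): [fun phi => T (Box phi)] is itself superlinear, and
    Hahn-Banach gives a state above it that agrees with it at any one chosen
    proposition ([state_tangent]); lying above it means being accessible.  Hence
    every proposition has at the point [T] the value [T phi]
    ([canonical_value]), and [T] satisfies [Gamma] in the model as soon as it
    does so as a linear functional.

    Propositions are a vector space only up to provable equality, so the
    Hahn-Banach argument is carried out directly on terms: a maximal superlinear
    functional is linear.  The suprema of chains, the one-step extensions and the
    bound coming from [Gamma] are all pointwise suprema of sets of reals with
    the same closure properties, treated once in [superlinear_sup]. *)

(** * Vector-space laws up to provable equality *)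

Section ProvableOrder.
Context {R : realType} {P : Type}.
Implicit Types (phi psi theta : prp R P) (r s : R).

Definition provable_le phi psi : Prop := theorem_of (phi <= psi)%A.
Definition provable_eq phi psi : Prop :=
  provable_le phi psi /\ provable_le psi phi.

Local Notation "phi <~ psi" := (provable_le phi psi) (at level 70).
Local Notation "phi <~> psi" := (provable_eq phi psi) (at level 70).

Lemma eq_axiom_provable phi psi : eq_axiom phi psi -> phi <~> psi.
Proof.
by move=> h; split; apply: thm_axiom; [exact: ax_eq_le|exact: ax_eq_ge].
Qed.

Lemma provable_le_refl phi : phi <~ phi.
Proof.
have [h1 h2] := eq_axiom_provable (ax_scale1 phi).
exact: thm_trans h2 h1.
Qed.

#[global] Instance provable_le_preorder : PreOrder provable_le.
Proof.
by split; [exact: provable_le_refl|move=> ? ? ?; exact: thm_trans].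
Qed.

#[global] Instance provable_eq_equivalence : Equivalence provable_eq.
Proof.
split.
- by move=> phi; split; reflexivity.
- by move=> phi psi [].
- by move=> ? ? ? [h1 h2] [h3 h4]; split;
    [exact: thm_trans h1 h3|exact: thm_trans h4 h2].
Qed.

#[global] Instance provable_eq_partial_order :
  PartialOrder provable_eq provable_le.
Proof. by move=> phi psi; split => - []. Qed.

#[global] Instance Plus_provable_le :
  Proper (respectful provable_le (respectful provable_le provable_le))
    (@Plus R P).
Proof.
move=> phi phi' h psi psi' h'.
transitivity (phi' + psi)%A; first exact: thm_add.
rewrite -> (eq_axiom_provable (ax_addC phi' psi)).
rewrite -> (eq_axiom_provable (ax_addC phi' psi')).
exact: thm_add.
Qed.

#[global] Instance Plus_provable_eq :
  Proper (respectful provable_eq (respectful provable_eq provable_eq))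
    (@Plus R P).
Proof. by move=> ? ? [h1 h2] ? ? [h3 h4]; split; apply: Plus_provable_le. Qed.

Lemma PlusC phi psi : (phi + psi <~> psi + phi)%A.
Proof. exact/eq_axiom_provable/ax_addC. Qed.

Lemma PlusA phi psi theta : (phi + (psi + theta) <~> (phi + psi) + theta)%A.
Proof. exact/eq_axiom_provable/ax_addA. Qed.

Lemma PlusACA phi psi theta chi :
  ((phi + psi) + (theta + chi) <~> (phi + theta) + (psi + chi))%A.
Proof.
rewrite -> !PlusA, <- (PlusA phi psi theta), (PlusC psi theta).
rewrite -> PlusA; reflexivity.
Qed.

Lemma Plus0l phi : (Real 0 + phi <~> phi)%A.
Proof. exact/eq_axiom_provable/ax_add0. Qed.

Lemma Plus0r phi : (phi + Real 0 <~> phi)%A.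
Proof. rewrite -> PlusC; exact: Plus0l. Qed.

Lemma ScaleDl r s phi : ((r + s)%R *: phi <~> r *: phi + s *: phi)%A.
Proof. exact/eq_axiom_provable/ax_scaleDl. Qed.

Lemma ScaleDr r phi psi : (r *: (phi + psi) <~> r *: phi + r *: psi)%A.
Proof. exact/eq_axiom_provable/ax_scaleDr. Qed.

Lemma ScaleA r s phi : (r *: (s *: phi) <~> (r * s)%R *: phi)%A.
Proof. exact/eq_axiom_provable/ax_scaleA. Qed.

Lemma Scale1 phi : (1 *: phi <~> phi)%A.
Proof. exact/eq_axiom_provable/ax_scale1. Qed.

Lemma Scale0 phi : (0 *: phi <~> Real 0)%A.
Proof. exact/eq_axiom_provable/ax_scale0. Qed.

Lemma PlusN phi : (phi + (-1) *: phi <~> Real 0)%A.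
Proof.
transitivity ((1 - 1 : R)%R *: phi)%A.
  rewrite -> ScaleDl, Scale1; reflexivity.
by rewrite subrr; exact: Scale0.
Qed.

Lemma PlusK phi psi : (phi <~> (phi + psi) - psi)%A.
Proof. rewrite /Minus; rewrite <- PlusA, PlusN, Plus0r; reflexivity. Qed.

Lemma Real_le r s : r <= s -> Real r <~ Real s.
Proof. by move=> rs; exact/thm_axiom/ax_real. Qed.

Lemma Scale_le r phi psi : 0 <= r -> phi <~ psi -> (r *: phi <~ r *: psi)%A.
Proof. by move=> r0; apply: thm_scale; exact: Real_le. Qed.

(** Only nonnegative scalars are monotone by rule.  Antitonicity of negation
    comes from cancellation:
    [- psi = (- psi + phi) - phi <= (- psi + psi) - phi]. *)
Lemma Neg_le phi psi : phi <~ psi -> ((-1) *: psi <~ (-1) *: phi)%A.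
Proof.
move=> h; rewrite -> (PlusK ((-1) *: psi)%A phi); rewrite /Minus.
transitivity (((-1) *: psi + psi) + (-1) *: phi)%A.
  by do 2?apply: Plus_provable_le => //; exact: provable_le_refl.
rewrite -> (PlusC _ psi), PlusN, Plus0l; reflexivity.
Qed.

(** The constant [One] is an order unit.  Quantifying over the scalar [r] gives
    the upper bounds of [phi] together with the lower ones, as the induction
    through [Scale] by a negative number requires. *)
Lemma Real_bound r phi : exists a, (Real a <~ r *: phi)%A.
Proof.
elim: phi r => [|p|phi IH psi IH'|s phi IH|phi IH] r.
- by exists r; exact: provable_le_refl.
- have [r0|/ltW r0] := leP 0 r.
    exists (r * 0); rewrite <- (ScaleA r 0 One).
    by apply: Scale_le => //; exact/thm_axiom/ax_atom_ge0.
  exists r; rewrite -(opprK r) -mulN1r; rewrite /Real; rewrite <- !ScaleA.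
  apply/Neg_le/Scale_le; first by rewrite oppr_ge0.
  exact/thm_axiom/ax_atom_le1.
- have [[a ha] [b hb]] := (IH r, IH' r); exists (a + b).
  rewrite /Real; rewrite -> ScaleDl, ScaleDr.
  exact: Plus_provable_le.
- have [a ha] := IH (r * s); exists a.
  by rewrite -> ScaleA.
- have [r0|/ltW r0] := leP 0 r.
    have [a ha] := IH r; exists a.
    rewrite <- (eq_axiom_provable (ax_box_real P a)).
    rewrite <- (eq_axiom_provable (ax_box_scale phi r0)).
    exact: thm_box.
  (* for r <= 0, [Box phi <= phi] already gives [r phi <= r Box phi] *)
  have [a ha] := IH r; exists a; rewrite -> ha.
  rewrite -(opprK r) -mulN1r; rewrite <- !ScaleA.
  apply/Neg_le/Scale_le; first by rewrite oppr_ge0.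
  exact/thm_axiom/ax_boxT.
Qed.

End ProvableOrder.

Notation "phi <~ psi" := (provable_le phi psi) (at level 70).
Notation "phi <~> psi" := (provable_eq phi psi) (at level 70).

(** * Superlinear functionals and Hahn-Banach *)

Section Superlinear.
Context {R : realType} {P : Type}.
Implicit Types (phi psi : prp R P) (r t : R) (q : prp R P -> R).

(** The condition on [Real r] is one-sided so that it passes to every larger
    functional; for linear functionals, the cases [r = 1] and [r = -1] turn it
    into an equality. *)
Record superlinear q : Prop := Superlinear {
  superlinear_real : forall r, r <= q (Real r);
  superlinear_mono : forall phi psi, phi <~ psi -> q phi <= q psi;
  superlinearD : forall phi psi, q phi + q psi <= q (phi + psi)%A;
  superlinearZ : forall r phi, 0 <= r -> r * q phi <= q (r *: phi)%A
}.

Record state_spec q : Prop := StateSpec {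
  state_real : forall r, q (Real r) = r;
  state_mono : forall phi psi, phi <~ psi -> q phi <= q psi;
  stateD : forall phi psi, q (phi + psi)%A = q phi + q psi;
  stateZ : forall r phi, q (r *: phi)%A = r * q phi
}.

(** The closure properties of a family of sets of reals that make its pointwise
    supremum superlinear.  They are stated up to a larger element, which is all
    that a supremum sees: in a chain of functionals, the sum of values of two
    members is only dominated by a value at the sum. *)
Record superlinear_family (S : prp R P -> set R) : Prop := SuperlinearFamily {
  family_real : forall r, exists2 c, S (Real r) c & r <= c;
  family_mono : forall phi psi a, phi <~ psi -> S phi a ->
    exists2 c, S psi c & a <= c;
  familyD : forall phi psi a b, S phi a -> S psi b ->
    exists2 c, S (phi + psi)%A c & a + b <= c;
  familyZ : forall r phi a, 0 <= r -> S phi a ->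
    exists2 c, S (r *: phi)%A c & r * a <= c;
  family0 : forall a, S (Real 0) a -> a <= 0
}.

Lemma superlinear_eq q phi psi : superlinear q -> phi <~> psi -> q phi = q psi.
Proof.
by move=> sq [h1 h2]; apply/eqP; rewrite eq_le !(superlinear_mono sq).
Qed.

Lemma superlinear0 q : superlinear q -> q (Real 0) = 0.
Proof.
move=> sq; apply/eqP; rewrite eq_le (superlinear_real sq) andbT.
have := superlinearD sq (Real 0) (Real 0).
by rewrite (superlinear_eq sq (Plus0l (Real 0))); lra.
Qed.

Lemma superlinear_neg q phi : superlinear q ->
  q phi + q ((-1) *: phi)%A <= 0.
Proof.
move=> sq; rewrite -(superlinear0 sq) -(superlinear_eq sq (PlusN phi)).
exact: superlinearD.
Qed.

Section Family.
Variables (S : prp R P -> set R) (famS : superlinear_family S).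

Lemma family_nonempty phi : S phi !=set0.
Proof.
have [a ha] := Real_bound 1 phi.
have [b Sb _] := family_real famS a.
have [|c Sc _] := family_mono famS _ Sb (psi := phi); last by exists c.
by rewrite -> ha, Scale1; reflexivity.
Qed.

(** An element of [S (- phi)] bounds [S phi], since their sum is dominated in
    [S 0], which has no positive element. *)
Lemma family_bounded phi : has_ubound (S phi).
Proof.
have [b Sb] := family_nonempty ((-1) *: phi)%A.
exists (- b) => a Sa.
have [c Sc ac] := familyD famS Sa Sb.
have [d Sd cd] := family_mono famS (proj1 (PlusN phi)) Sc.
by have := family0 famS Sd; lra.
Qed.

Lemma le_sup_family phi a : S phi a -> a <= sup (S phi).
Proof. exact/ub_le_sup/family_bounded. Qed.

Lemma superlinear_sup : superlinear (fun phi => sup (S phi)).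
Proof.
have leS phi a : (exists2 c, S phi c & a <= c) -> a <= sup (S phi).
  by move=> [c Sc ac]; exact: le_trans (le_sup_family Sc).
split.
- by move=> r; exact/leS/family_real.
- move=> phi psi h; apply: ge_sup; first exact: family_nonempty.
  by move=> a Sa; exact/leS/(family_mono famS h).
- move=> phi psi; rewrite -lerBrDr; apply: ge_sup.
    exact: family_nonempty.
  move=> a Sa; rewrite lerBrDr -lerBrDl; apply: ge_sup.
    exact: family_nonempty.
  by move=> b Sb; rewrite lerBrDl; exact/leS/familyD.
- move=> r phi; rewrite le_eqVlt => /predU1P[<-|r0].
    by rewrite mul0r; have [a Sa] := family_nonempty phi;
      apply: leS; have := familyZ famS (lexx 0) Sa; rewrite mul0r.
  rewrite -ler_pdivlMl//; apply: ge_sup; first exact: family_nonempty.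
  by move=> a Sa; rewrite ler_pdivlMl//; exact/leS/familyZ/Sa/ltW.
Qed.

End Family.

Definition shift_family q psi phi : set R :=
  [set a | exists2 t, 0 <= t & a = q (phi + t *: psi)%A - t * q psi].

(** The one-dimensional extension step of Hahn-Banach: the least superlinear
    functional above [q] whose value at [- psi] is at least [- q psi].  Such a
    functional [f] satisfies [f phi >= f (phi + t psi) + t f (- psi)], hence
    [f phi >= q (phi + t psi) - t q psi], for every [t >= 0]. *)
Definition shift q psi phi : R := sup (shift_family q psi phi).

Lemma shift_family_self q psi phi :
  superlinear q -> shift_family q psi phi (q phi).
Proof.
move=> sq; exists 0 => //; rewrite mul0r subr0; apply: (superlinear_eq sq).
rewrite -> Scale0, Plus0r; reflexivity.
Qed.

Lemma shift_familyP q psi :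
  superlinear q -> superlinear_family (shift_family q psi).
Proof.
move=> sq; split.
- move=> r; exists (q (Real r)); last exact: superlinear_real.
  exact: shift_family_self.
- move=> phi phi' _ h [t t0 ->].
  exists (q (phi' + t *: psi)%A - t * q psi); first by exists t.
  rewrite lerD2r; apply: (superlinear_mono sq).
  by apply: Plus_provable_le => //; exact: provable_le_refl.
- move=> phi phi' _ _ [t t0 ->] [s s0 ->].
  exists (q ((phi + phi') + (t + s)%R *: psi)%A - (t + s) * q psi).
    by exists (t + s) => //; exact: addr_ge0.
  rewrite mulrDl addrACA -opprD lerD2r.
  apply: le_trans (superlinearD sq _ _) _; apply: (superlinear_mono sq).
  rewrite -> ScaleDl, PlusACA; reflexivity.
- move=> r phi _ r0 [t t0 ->].
  exists (q (r *: phi + (r * t)%R *: psi)%A - (r * t) * q psi).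
    by exists (r * t) => //; exact: mulr_ge0.
  rewrite mulrBr mulrA lerD2r.
  apply: le_trans (superlinearZ sq _ r0) _; apply: (superlinear_mono sq).
  rewrite <- ScaleA, ScaleDr; reflexivity.
- (* the inequality is [q (t psi) <= t q psi], homogeneity at 1 / t *)
  move=> _ [t t0 ->]; rewrite subr_le0.
  rewrite (superlinear_eq sq (Plus0l _)).
  have [->|tn0] := eqVneq t 0.
    by rewrite (superlinear_eq sq (Scale0 _)) (superlinear0 sq) mul0r.
  rewrite -ler_pdivrMl ?lt_def ?tn0//.
  have ti : 0 <= t^-1 by rewrite invr_ge0.
  apply: le_trans (superlinearZ sq _ ti) _; apply: (superlinear_mono sq).
  by rewrite -> ScaleA; rewrite mulVf//; rewrite -> Scale1; reflexivity.
Qed.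

Lemma superlinear_shift q psi : superlinear q -> superlinear (shift q psi).
Proof. by move=> sq; exact/superlinear_sup/shift_familyP. Qed.

Lemma le_shift q psi phi : superlinear q -> q phi <= shift q psi phi.
Proof.
move=> sq; apply: (le_sup_family (shift_familyP psi sq)).
exact: shift_family_self.
Qed.

Lemma shiftN q psi : superlinear q -> - q psi <= shift q psi ((-1) *: psi)%A.
Proof.
move=> sq; apply: (le_sup_family (shift_familyP psi sq)).
exists 1 => //; rewrite mul1r -[LHS]add0r; congr (_ - _).
rewrite -(superlinear0 sq); apply: (superlinear_eq sq).
rewrite -> Scale1, PlusC, PlusN; reflexivity.
Qed.

(** Negation exchanges superadditivity and subadditivity, so an odd superlinear
    functional is additive. *)
Lemma odd_superlinear_state q : superlinear q ->
  (forall phi, - q phi <= q ((-1) *: phi)%A) -> state_spec q.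
Proof.
move=> sq odd_le.
have oddq phi : q ((-1) *: phi)%A = - q phi.
  by apply/eqP; rewrite eq_le odd_le andbT; have := superlinear_neg phi sq; lra.
have posZ r phi : 0 <= r -> q (r *: phi)%A = r * q phi.
  move=> r0; apply/eqP; rewrite eq_le (superlinearZ sq)// andbT.
  rewrite -lerN2 -mulrN -!oddq; apply: le_trans (superlinearZ sq _ r0) _.
  apply: (superlinear_mono sq); rewrite -> !ScaleA.
  by rewrite mulrC; reflexivity.
have allZ r phi : q (r *: phi)%A = r * q phi.
  have [|/ltW r0] := leP 0 r; first exact: posZ.
  rewrite -[in LHS](opprK r) -mulN1r -(superlinear_eq sq (ScaleA _ _ _)).
  by rewrite oddq posZ ?oppr_ge0// mulNr opprK.
have q1 : q One = 1.
  have le1 : 1 <= q One.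
    by rewrite -(superlinear_eq sq (Scale1 _)); exact: superlinear_real.
  have : -1 <= q (Real (-1)) by exact: superlinear_real.
  by rewrite allZ; lra.
split => //.
- by move=> r; rewrite allZ q1 mulr1.
- exact: superlinear_mono.
- move=> phi psi; apply/eqP; rewrite eq_le (superlinearD sq) andbT.
  rewrite -lerN2 opprD -!oddq (superlinear_eq sq (ScaleDr _ _ _)).
  exact: superlinearD.
Qed.

Definition chain_family (A : set (prp R P -> R)) phi : set R :=
  [set a | exists2 q, A q & a = q phi].

Lemma chain_familyP (A : set (prp R P -> R)) : A !=set0 ->
  (forall q, A q -> superlinear q) ->
  total_on A (fun q q' => forall phi, q phi <= q' phi) ->
  superlinear_family (chain_family A).
Proof.
move=> [q0 Aq0] sA totA; split.
- by move=> r; exists (q0 (Real r)); [exists q0|exact/superlinear_real/sA].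
- move=> phi psi _ h [q Aq ->]; exists (q psi); first by exists q.
  exact/(superlinear_mono (sA _ Aq)).
- move=> phi psi _ _ [q Aq ->] [q' Aq' ->].
  have [qq'|q'q] := totA _ _ Aq Aq'.
    exists (q' (phi + psi)%A); first by exists q'.
    by apply: le_trans (superlinearD (sA _ Aq') _ _); rewrite lerD2r.
  exists (q (phi + psi)%A); first by exists q.
  by apply: le_trans (superlinearD (sA _ Aq) _ _); rewrite lerD2l.
- move=> r phi _ r0 [q Aq ->]; exists (q (r *: phi)%A); first by exists q.
  exact/(superlinearZ (sA _ Aq)).
- by move=> _ [q Aq ->]; rewrite (superlinear0 (sA _ Aq)).
Qed.

(** Zorn's lemma: the supremum of a chain is superlinear, because two members
    can always be replaced by the larger one. *)
Lemma superlinear_maximal q : superlinear q ->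
  exists q', [/\ superlinear q', forall phi, q phi <= q' phi &
    forall q'', superlinear q'' -> (forall phi, q' phi <= q'' phi) ->
      forall phi, q'' phi <= q' phi].
Proof.
move=> sq.
pose above := {q' | superlinear q' /\ forall phi, q phi <= q' phi}.
pose mk_above q' (sq' : superlinear q') (qq' : forall phi, q phi <= q' phi) :
  above := exist _ q' (conj sq' qq').
pose le_above (u v : above) := `[< forall phi, sval u phi <= sval v phi >].
have [] := @ZL_preorder above (mk_above q sq (fun phi => lexx _)) le_above.
- by move=> u; exact/asboolP.
- move=> u v w /asboolP uv /asboolP vw; apply/asboolP => phi.
  exact: le_trans (vw _).
- move=> A totA.
  have [[u0 Au0]|A0] := pselect (A !=set0); last first.
    exists (mk_above q sq (fun phi => lexx _)) => u Au.
    by case: A0; exists u.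
  have famA : superlinear_family (chain_family (sval @` A)).
    apply: chain_familyP.
    - by exists (sval u0), u0.
    - by move=> _ [u _ <-]; have [] := svalP u.
    - move=> _ _ [u Au <-] [v Av <-].
      by have [/asboolP|/asboolP] := totA _ _ Au Av; [left|right].
  have le_lub u phi : A u -> sval u phi <= sup (chain_family (sval @` A) phi).
    by move=> Au; apply: (le_sup_family famA); exists (sval u) => //; exists u.
  have lub_above phi : q phi <= sup (chain_family (sval @` A) phi).
    by apply: le_trans (le_lub u0 _ Au0); have [_] := svalP u0; exact.
  exists (mk_above _ (superlinear_sup famA) lub_above) => u Au.
  by apply/asboolP => phi; exact: le_lub.
- move=> [q' [sq' qq']] maxq'; exists q'; split => // q'' sq'' q'q''.
  have qq'' phi : q phi <= q'' phi by exact: le_trans (q'q'' _).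
  have /asboolP := maxq' (mk_above q'' sq'' qq'') (introT (asboolP _) q'q'').
  by [].
Qed.

(** A maximal [T] equals each [shift T phi], hence satisfies
    [- T phi <= T (- phi)] and is odd. *)
Lemma state_above q : superlinear q ->
  exists2 T, state_spec T & forall phi, q phi <= T phi.
Proof.
move=> sq; have [T [sT qT maxT]] := superlinear_maximal sq.
exists T => //; apply: odd_superlinear_state => // phi.
apply: le_trans (shiftN phi sT) _; apply: maxT (superlinear_shift phi sT) _ _.
by move=> psi; exact: le_shift.
Qed.

(** Shifting by [phi] before extending pins the value at [phi]: a state above
    [shift q phi] satisfies [- T phi >= - q phi]. *)
Lemma state_tangent q phi : superlinear q ->
  exists T, [/\ state_spec T, forall psi, q psi <= T psi & T phi = q phi].
Proof.
move=> sq; have [T sT qT] := state_above (superlinear_shift phi sq).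
have leT psi : q psi <= T psi by exact: le_trans (le_shift phi psi sq) (qT _).
exists T; split => //; apply/eqP; rewrite eq_le leT andbT.
have := le_trans (shiftN phi sq) (qT _).
by rewrite (stateZ sT) mulN1r lerN2.
Qed.

End Superlinear.

(** * States of a consistent theory *)

Section DerivableState.
Context {R : realType} {P : Type}.
Variable Gamma : theory R P.
Implicit Types (phi psi theta : prp R P).

Lemma derivable_max S S' : derivable_from Gamma S -> derivable_from Gamma S' ->
  exists n, derivable_at Gamma n S /\ derivable_at Gamma n S'.
Proof.
move=> [n Sn] [m Sm]; exists (maxn n m).+1.
split; [apply: der_keep Sn|apply: der_keep Sm]; rewrite ltnS.
  exact: leq_maxl.
exact: leq_maxr.
Qed.

Lemma provable_derivable phi psi :
  phi <~ psi -> derivable_from Gamma (phi <= psi)%A.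
Proof. by move=> h; exists 0%N; exact: der_thm. Qed.

Lemma derivable_trans phi psi theta :
  derivable_from Gamma (phi <= psi)%A ->
  derivable_from Gamma (psi <= theta)%A ->
  derivable_from Gamma (phi <= theta)%A.
Proof.
move=> h1 h2; have [n [d1 d2]] := derivable_max h1 h2.
by exists n.+1; exact: der_trans d1 d2.
Qed.

Lemma derivable_add phi psi theta : derivable_from Gamma (phi <= psi)%A ->
  derivable_from Gamma (phi + theta <= psi + theta)%A.
Proof. by move=> [n d]; exists n.+1; exact: der_add d. Qed.

Lemma derivable_scale (r : R) phi psi : 0 <= r ->
  derivable_from Gamma (phi <= psi)%A ->
  derivable_from Gamma (r *: phi <= r *: psi)%A.
Proof.
move=> r0 d; have := provable_derivable (Real_le r0).
by move=> /derivable_max -/(_ _ d)[n [d1 d2]]; exists n.+1; exact: der_scale d2.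
Qed.

Lemma derivable_sub phi psi : derivable_from Gamma (phi <= psi)%A ->
  derivable_from Gamma (Real 0 <= psi - phi)%A.
Proof.
move=> /(derivable_add ((-1) *: phi)%A).
by apply: derivable_trans; apply: provable_derivable; case: (PlusN phi).
Qed.

Definition derivable_bound phi : set R :=
  [set a | derivable_from Gamma (Real a <= phi)%A].

(** Consistency bounds the family at 0: a derivable [a <= 0] with
    [a > 0] rescales to [1 <= 0]. *)
Lemma derivable_boundP : consistent Gamma ->
  superlinear_family derivable_bound.
Proof.
move=> consG; split.
- by move=> r; exists r => //; exact/provable_derivable/provable_le_refl.
- move=> phi psi a h d; exists a => //.
  exact/(derivable_trans d)/provable_derivable.
- move=> phi psi a b da db; exists (a + b) => //.
  apply: derivable_trans (provable_derivable (proj1 (ScaleDl a b One))) _.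
  apply: derivable_trans (derivable_add (Real b) da) _.
  apply: derivable_trans (provable_derivable (proj1 (PlusC _ _))) _.
  apply: derivable_trans (derivable_add phi db) _.
  exact: (provable_derivable (proj1 (PlusC _ _))).
- move=> r phi a r0 d; exists (r * a) => //.
  apply: derivable_trans (provable_derivable (proj2 (ScaleA r a One))) _.
  exact: derivable_scale.
- move=> a d; rewrite leNgt; apply/negP => a0; apply: consG.
  have ai : 0 <= a^-1 by rewrite invr_ge0 ltW.
  have := derivable_scale ai d.
  move=> /derivable_trans -/(_ (Real 0)) h.
  apply: derivable_trans (h _); apply: provable_derivable.
    rewrite /Real; rewrite -> ScaleA.
    by rewrite mulVf ?gt_eqF//; rewrite -> Scale1; reflexivity.
  rewrite /Real; rewrite -> ScaleA.
  by rewrite mulr0; reflexivity.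
Qed.

Lemma consistent_state : consistent Gamma ->
  exists2 T, state_spec T &
    forall phi psi, Gamma (phi <= psi)%A -> T phi <= T psi.
Proof.
move=> /derivable_boundP famG.
have [T sT leT] := state_above (superlinear_sup famG); exists T => // phi psi G.
have /derivable_sub/(le_sup_family famG) : derivable_from Gamma (phi <= psi)%A.
  by exists 0%N; exact: der_hyp.
move=> /le_trans/(_ (leT _)).
by rewrite /Minus (stateD sT) (stateZ sT) mulN1r subr_ge0.
Qed.

End DerivableState.

(** * The canonical model *)

Section CanonicalModel.
Context {R : realType} {P : Type}.
Implicit Types (phi psi : prp R P).

Definition state : Type := {T : prp R P -> R | state_spec T}.

HB.instance Definition _ := gen_eqMixin state.
HB.instance Definition _ := gen_choiceMixin state.

Definition state_access (T T' : state) : Prop :=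
  forall phi, sval T (Box phi) <= sval T' phi.

Lemma state_access_refl T : state_access T T.
Proof.
by move=> phi; apply: (state_mono (svalP T)); exact/thm_axiom/ax_boxT.
Qed.

Lemma state_access_trans T1 T2 T3 :
  state_access T1 T2 -> state_access T2 T3 -> state_access T1 T3.
Proof.
move=> h12 h23 phi; apply: le_trans (h23 _); apply: le_trans (h12 _).
by apply: (state_mono (svalP T1)); exact/thm_axiom/ax_box4.
Qed.

(** A coarser topology, generated by the sets of states where some [Box phi]
    exceeds a constant, would be closer to the syntax; with the up-closed sets
    the least neighbourhood of [T] is available and the envelope becomes a plain
    infimum over it. *)
Definition access_closed (U : set state) : Prop :=
  forall T T', U T -> state_access T T' -> U T'.

Lemma access_closedT : access_closed setT.
Proof. by []. Qed.

Lemma access_closedI : setI_closed access_closed.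
Proof.
by move=> U V cU cV T T' [UT VT] TT'; split; [exact: cU TT'|exact: cV TT'].
Qed.

Lemma access_closed_bigcup (I : Type) (f : I -> set state) :
  (forall i, access_closed (f i)) -> access_closed (\bigcup_i f i).
Proof. by move=> cf T T' [i _ fT] TT'; exists i => //; exact: cf TT'. Qed.

HB.instance Definition _ := isOpenTopological.Build state
  access_closedT access_closedI access_closed_bigcup.

(** Superadditivity of [Box] is its subtraction axiom applied to
    [phi = (phi + psi) - psi]. *)
Lemma superlinear_box (T : prp R P -> R) : state_spec T ->
  superlinear (fun phi => T (Box phi)).
Proof.
move=> sT; split => /=.
- move=> r; rewrite -[leLHS](state_real sT); apply: (state_mono sT).
  by case: (eq_axiom_provable (ax_box_real P r)).
- by move=> phi psi h; apply: (state_mono sT); exact: thm_box.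
- move=> phi psi.
  have /(state_mono sT) : Box phi <~ (Box (phi + psi) - Box psi)%A.
    apply: thm_trans (thm_axiom (ax_box_sub _ _)).
    by apply: thm_box; case: (PlusK phi psi).
  by rewrite /Minus (stateD sT) (stateZ sT) mulN1r lerBrDr.
- move=> r phi r0; rewrite -(stateZ sT); apply: (state_mono sT).
  by case: (eq_axiom_provable (ax_box_scale phi r0)).
Qed.

Lemma state_box_attained (T : state) phi :
  exists2 T', state_access T T' & sval T' phi = sval T (Box phi).
Proof.
have [T' [sT' leT' eqT']] := state_tangent phi (superlinear_box (svalP T)).
by exists (exist _ T' sT').
Qed.

(** The least neighbourhood [state_access T] gives the lower bound for the
    envelope.  The attaining state lies in every neighbourhood of [T] and gives
    the upper bound. *)
Lemma state_envelope phi (T : state) :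
  lsc_envelope (fun T' : state => sval T' phi) T = sval T (Box phi).
Proof.
have [T0 TT0 eqT0] := state_box_attained T phi.
have [a le_phi] := Real_bound 1 phi.
have bounded (U : set state) : has_lbound ((fun T' => sval T' phi) @` U).
  exists a => _ [T' _ <-]; rewrite -[leLHS](state_real (svalP T')).
  by apply: (state_mono (svalP T')); rewrite -> le_phi, Scale1; reflexivity.
have up_nbhs : open_nbhs T (state_access T).
  split; last exact: state_access_refl.
  by move=> T1 T2; exact: state_access_trans.
have box_ub : ubound [set inf ((fun T' => sval T' phi) @` U) | U in open_nbhs T]
    (sval T (Box phi)).
  move=> _ [U [openU UT] <-]; rewrite -eqT0; apply: ge_inf => //.
  by exists T0 => //; exact: openU TT0.
apply/eqP; rewrite eq_le; apply/andP; split.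
  apply: ge_sup => //.
  exists (inf ((fun T' => sval T' phi) @` state_access T)).
  by exists (state_access T).
apply: (@le_trans _ _ (inf ((fun T' => sval T' phi) @` state_access T))).
  apply: lb_le_inf.
    by exists (sval T phi), T => //; exact: state_access_refl.
  by move=> _ [T' TT' <-]; exact: TT'.
by apply: ub_le_sup; [exists (sval T (Box phi))|exists (state_access T)].
Qed.

Lemma state_atom01 (p : P) (T : state) : 0 <= sval T (Atom p) <= 1.
Proof.
apply/andP; split.
  rewrite -[leLHS](state_real (svalP T)).
  exact/(state_mono (svalP T))/thm_axiom/ax_atom_ge0.
rewrite -[leRHS](state_real (svalP T)); apply: (state_mono (svalP T)).
rewrite /Real; rewrite -> Scale1.
exact/thm_axiom/ax_atom_le1.
Qed.

Definition canonical_model : topological_model R P :=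
  TopologicalModel (space := state) state_atom01.

Lemma canonical_value phi (T : state) :
  value (M := canonical_model) phi T = sval T phi.
Proof.
elim: phi T => [|p|phi IH psi IH'|r phi IH|phi IH] T //=.
- rewrite -[LHS](state_real (svalP T)); apply/eqP; rewrite eq_le.
  apply/andP; split; apply: (state_mono (svalP T));
    by case: (Scale1 (One : prp R P)).
- by rewrite IH IH' (stateD (svalP T)).
- by rewrite IH (stateZ (svalP T)).
- by rewrite -state_envelope; congr lsc_envelope; exact/funext.
Qed.

End CanonicalModel.

Theorem theorem4p3 (R : realType) (P : countType) (Gamma : theory R P) :
  consistent Gamma -> satisfiable Gamma.
Proof.
move=> /consistent_state[T sT satT].
exists (canonical_model (R := R) (P := P)), (exist _ T sT) => -[phi psi] G.
by rewrite /sat !canonical_value; exact: satT.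
Qed.
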